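(* Let $T\in\mathbb{N}$ and let $(r_0,r_1,\ldots,r_{2T-2})\in\mathbb{C}^{2T-1}$. For $m=1,\ldots,T$ let $C^{m}$ be the complex symmetric $m\times m$ matrix with entries $$\{C^{m}\}_{ij}=r_0\sum_{k=0}^{m-\max\{i,j\}} r_{|i-j|+2k},\qquad i,j=1,\ldots,m.$$ Then $(r_0,r_1,\ldots,r_{2T-2})$ is the response vector of a dynamical system $$\begin{cases} u_{n,t+1}+u_{n,t-1}-a_n u_{n+1,t}-a_{n-1}u_{n-1,t}-b_n u_{n,t}=0,& n\in\mathbb{N},\ t\in\mathbb{N}\cup\{0\},\\ u_{n,-1}=u_{n,0}=0,& n\in\mathbb{N},\\ u_{0,t}=f_t,& t\in\mathbb{N}\cup\{0\},\end{cases}$$ for some complex coefficients $a_0,a_1,\ldots$ (all nonzero) and $b_1,b_2,\ldots$, if and only if for every $k=0,1,\ldots,T-1$ the matrix $C^{T-k}$ is an isomorphism of $\mathbb{C}^{T-k}$.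
   Context: $\mathbb{N}=\{1,2,\ldots\}$. For given complex sequences $\{a_0,a_1,\ldots\}$ with all $a_i\neq 0$ and $\{b_1,b_2,\ldots\}$, and a complex sequence (control) $f=(f_0,f_1,\ldots)$, the solution of the dynamical system in the claim is denoted $u^f_{n,t}$. The response vector $(r_0,r_1,\ldots,r_{2T-2})$ of the system is given by $r_k=u^\delta_{1,k+1}$, $k=0,1,\ldots,2T-2$, where $\delta=(1,0,0,\ldots)$; in particular $r_0=a_0$. (These values depend only on $a_0,\ldots,a_{T-1}$ and $b_1,\ldots,b_{T-1}$.) *)

(* Defs.v *)
From mathcomp Require Import all_boot all_order all_algebra.
From mathcomp Require Import reals.
From mathcomp Require Import complex.

Set Implicit Arguments.
Unset Strict Implicit.
Unset Printing Implicit Defensive.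

Import GRing.Theory.
Local Open Scope ring_scope.

(* [u n t] stands for u_{n,t}: n ranges over nat and time over int, so that the
   initial layer t = -1 is a genuine index.  The values u_{n,t} with t < -1,
   u_{0,-1} and the coefficient b_0 do not occur in the system.
   All the values u_{n,t} that do occur are determined by a, b, f, through
   forward recursion in t. *)
Definition is_solution (K : comNzRingType) (a b f : nat -> K)
    (u : nat -> int -> K) : Prop :=
  [/\ forall n t : nat, (0 < n)%N ->
        u n (t%:Z + 1) + u n (t%:Z - 1) - a n * u n.+1 t%:Z
          - a n.-1 * u n.-1 t%:Z - b n * u n t%:Z = 0,
      forall n : nat, (0 < n)%N -> u n (- 1) = 0 /\ u n 0 = 0 &
      forall t : nat, u 0%N t%:Z = f t].

Definition delta (K : comNzRingType) (t : nat) : K := (t == 0%N)%:R.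

Definition is_response_vector (K : comNzRingType) (a b : nat -> K) (T : nat)
    (r : (2 * T - 1).-tuple K) : Prop :=
  exists2 u, is_solution a b (@delta K) u &
    forall k : nat, (k <= 2 * T - 2)%N -> r`_k = u 1%N (k%:Z + 1).

(* The indices i, j : 'I_m start from 0, hence the successors in the maximum;
   the sum runs over k = 0, ..., m - max(i.+1, j.+1), both ends included.
   For m <= T every index of r below is at most 2 * T - 2, i.e. within range. *)
Definition connecting_mx (K : comNzRingType) (T : nat)
    (r : (2 * T - 1).-tuple K) (m : nat) : 'M[K]_m :=
  \matrix_(i < m, j < m)
    (r`_0 * \sum_(0 <= k < (m - maxn i.+1 j.+1).+1) r`_(`|i - j| + 2 * k)).

(* Main.v *)
(* Write u_{n,t} for the solution with control delta and let
   G(s,t) = sum_n u_{n,s} u_{n,t}.  Symmetry of the Jacobi operator gives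
   G(s+1,t+1) = G(s,t) + a_0 u_{1,s+t+1}, hence C^m = W^T W, where the columns of
   W are the states at times m, ..., 1.  Up to the order of its columns W is
   triangular with diagonal entries a_0 ... a_{n-1}, so C^m is invertible iff
   a_0, ..., a_{m-1} are nonzero.  Conversely, the coefficients are found one
   pair at a time: given a_0, ..., a_{m-1} and b_1, ..., b_{m-1}, the value
   r_{2m-1} is affine in b_m and r_{2m} is affine in a_m^2, both with leading
   coefficient (a_0 ... a_{m-1})^2 / a_0.  A complex square root provides a_m;
   were it zero, C^{m+1} = W^T W would be singular. *)

Require Import Defs.
From mathcomp Require Import all_boot all_order all_algebra.
From mathcomp Require Import reals complex.
From mathcomp Require Import perm zify ring.

Set Implicit Arguments.
Unset Strict Implicit.
Unset Printing Implicit Defensive.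

Import GRing.Theory Num.Theory.
Local Open Scope ring_scope.

(* [wave a b t n] is u^delta_{n,t}. *)
Fixpoint wave (K : comNzRingType) (a b : nat -> K) (t n : nat) : K :=
  match t, n with
  | 0, _ => (n == 0)%:R
  | _, 0 => 0
  | 1, _ => a 0 *+ (n == 1)
  | (t''.+1 as t').+1, n'.+1 =>
      a n * wave a b t' n.+1 + a n' * wave a b t' n' + b n * wave a b t' n
      - wave a b t'' n
  end.

(** * Fundamental solution and finite speed of propagation *)

Section Wave.
Variable K : comNzRingType.
Implicit Types a b : nat -> K.

Lemma waveSS a b t n :
  wave a b t.+2 n.+1 =
    a n.+1 * wave a b t.+1 n.+2 + a n * wave a b t.+1 n
    + b n.+1 * wave a b t.+1 n.+1 - wave a b t n.+1.
Proof. by []. Qed.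

Lemma wave11 a b : wave a b 1 1 = a 0.
Proof. by []. Qed.

Lemma waveS0 a b t : wave a b t.+1 0 = 0.
Proof. by case: t. Qed.

Lemma wave_eq0 a b t n : (t < n)%N -> wave a b t n = 0.
Proof.
elim/ltn_ind: t n => -[|[|t]] IH [|n] // tn; first by case: n tn.
by rewrite waveSS !IH ?mulr0 ?addr0 ?subr0 //; lia.
Qed.

Lemma wave_diagS a b t : (0 < t)%N -> wave a b t.+1 t.+1 = a t * wave a b t t.
Proof.
case: t => // t _; rewrite waveSS [wave _ _ _ t.+3]wave_eq0 //.
by rewrite ![wave _ _ _ t.+2]wave_eq0 // !mulr0 add0r addr0 subr0.
Qed.

Lemma wave_diag a b t : wave a b t.+1 t.+1 = \prod_(i < t.+1) a i.
Proof.
elim: t => [|t IH]; first by rewrite big_ord1.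
by rewrite wave_diagS // IH [in RHS]big_ord_recr mulrC.
Qed.

Lemma wave_solution a b :
  is_solution a b (@delta K)
    (fun n t => if t is Posz t then wave a b t n else 0).
Proof.
split=> [[|n] [|t] // _|[] //|[] //].
- rewrite /= !eqSS mulr0 mulr0 !subr0 addr0.
  by case: n => [|n]; rewrite /= ?mulr1 ?mulr0 subrr.
- rewrite -PoszD addn1 (_ : t.+1%:Z - 1 = t) /=; last by lia.
  by ring.
- exact: waveS0.
Qed.

Lemma solution_wave a b u : is_solution a b (@delta K) u ->
  forall t n, u n t%:Z = wave a b t n.
Proof.
case=> ueq u0 udelta; elim/ltn_ind=> -[|[|t]] IH [|n].
- by rewrite udelta.
- by case: (u0 n.+1).
- by rewrite udelta.
- have:= ueq n.+1 0%N isT; have [uN1 uZ] := u0 n.+1 isT.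
  have [_ uSZ] := u0 n.+2 isT.
  rewrite add0r sub0r uN1 uZ uSZ addr0 !mulr0 !subr0 [_.-1]/= IH //.
  move/eqP; rewrite subr_eq0 => /eqP->.
  by case: n {uN1 uZ uSZ} => [|n]; rewrite /= ?mulr1 ?mulr0.
- by rewrite udelta waveS0.
- have:= ueq n.+1 t.+1 isT.
  rewrite -PoszD addn1 (_ : t.+1%:Z - 1 = t); last by lia.
  rewrite !(IH t.+1) // (IH t) // waveSS /= => /eqP; rewrite -!addrA addr_eq0 => /eqP ->.
  by ring.
Qed.

Lemma is_response_vectorP a b T (r : (2 * T - 1).-tuple K) :
  is_response_vector a b r <->
  forall k, (k <= 2 * T - 2)%N -> r`_k = wave a b k.+1 1.
Proof.
split=> [[u usol ur] k kT|ur].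
  by rewrite ur // -PoszD addn1 (solution_wave usol).
eexists; [exact: wave_solution | by move=> k kT; rewrite ur //= addn1].
Qed.

(* Finite speed of propagation: the index a_i labels the edge (i, i+1), and a
   path from site 0 to an edge or site near x and back to n must fit in time t. *)
Lemma wave_local a b a' b' t n :
    (forall i, (2 * i + 2 <= t + n)%N -> a i = a' i) ->
    (forall i, (2 * i + 1 <= t + n)%N -> b i = b' i) ->
  wave a b t n = wave a' b' t n.
Proof.
elim/ltn_ind: t n => -[|[|t]] IH [|n] // ha hb.
  by case: n ha hb => [|n] // ha _; rewrite /= ha.
have [tn|nt] := ltnP t.+2 n.+1; first by rewrite !wave_eq0.
have ha' i : (2 * i + 2 <= t.+1 + n.+2)%N -> a i = a' i by move=> ?; apply: ha; lia.
have hb' i : (2 * i + 1 <= t.+1 + n.+2)%N -> b i = b' i by move=> ?; apply: hb; lia.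
rewrite !waveSS; congr (_ + _ + _ - _).
(* Outside the light cone the hypotheses need not cover [a n.+1], but the factor it multiplies
   vanishes. *)
- have [tn|nt'] := ltnP t.+1 n.+2; first by rewrite !wave_eq0 ?mulr0.
  by rewrite IH // ha //; lia.
- rewrite ha; last by lia.
  by rewrite IH // => i ?; [apply: ha | apply: hb]; lia.
- have [tn|nt'] := ltnP t.+1 n.+1; first by rewrite !wave_eq0 ?mulr0.
  rewrite hb; last by lia.
  by rewrite IH // => i ?; [apply: ha | apply: hb]; lia.
- by rewrite IH // => i ?; [apply: ha | apply: hb]; lia.
Qed.

#[global] Arguments wave : simpl never.

(** * Inner products of states at two times *)

Definition wave_gram a b N s t : K :=
  \sum_(n < N) wave a b s n.+1 * wave a b t n.+1.

Lemma wave_gramC a b N s t : wave_gram a b N s t = wave_gram a b N t s.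
Proof. by apply: eq_bigr => n _; rewrite mulrC. Qed.

Lemma wave_gram_widen a b N s t : (s <= N)%N ->
  wave_gram a b N s t = wave_gram a b s s t.
Proof.
move=> sN; rewrite /wave_gram
  (big_ord_widen N (fun n => wave a b s n.+1 * wave a b t n.+1) sN).
rewrite [LHS](bigID (fun n : 'I_N => n < s)%N) /= [X in _ + X]big1 ?addr0 // => n.
by rewrite -leqNgt => sn; rewrite wave_eq0 ?mul0r.
Qed.

(* The Jacobi operator is symmetric, so it can be moved from one factor to the
   other; the boundary term at site 0 vanishes since u_{0,t} = 0 for t > 0. *)
Lemma wave_gram_exchange a b N s t : (s < N)%N -> (t < N)%N ->
  wave_gram a b N s.+2 t.+1 + wave_gram a b N s t.+1 =
  wave_gram a b N s.+1 t.+2 + wave_gram a b N s.+1 t.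
Proof.
move=> sN tN; apply/eqP; rewrite -subr_eq0 -!big_split -sumrB /=.
pose q n := a n * (wave a b s.+1 n.+1 * wave a b t.+1 n
  - wave a b s.+1 n * wave a b t.+1 n.+1).
rewrite (eq_bigr (fun n : 'I_N => q n.+1 - q n)); last first.
  by move=> n _; rewrite /= !waveSS /q; ring.
rewrite -(big_mkord xpredT (fun n => q n.+1 - q n)) telescope_sumr //.
by rewrite /q !waveS0 !(@wave_eq0 _ _ _ N.+1) //; apply/eqP; ring.
Qed.

(** Induction on [s]: the exchange identity trades the times [s.+2], [t.+1] for [s.+1], [t.+2], with
    the same sum. A common large [N] keeps the far boundary term zero. *)
Lemma wave_gramSS_aux a b N s t : (s + t < N)%N ->
  wave_gram a b N s.+1 t.+1 = wave_gram a b N s t + a 0 * wave a b (s + t).+1 1.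
Proof.
elim: s t => [|s IH] t stN.
  case: N stN => // N _; rewrite /wave_gram !big_ord_recl /= !big1 => [|i _|i _].
  - by rewrite wave11 (@wave_eq0 _ _ 0) // mul0r !addr0 add0r.
  - by rewrite wave_eq0 ?mul0r.
  - by rewrite wave_eq0 ?mul0r.
apply: (addIr (wave_gram a b N s t.+1)).
rewrite wave_gram_exchange; [|lia..].
rewrite (IH t.+1) ?addnS; [rewrite addSn; ring | lia].
Qed.

Lemma wave_gramSS a b s t :
  wave_gram a b s.+1 s.+1 t.+1 = wave_gram a b s s t + a 0 * wave a b (s + t).+1 1.
Proof.
have := @wave_gramSS_aux a b (s + t).+1 s t (ltnSn _).
by rewrite !wave_gram_widen //; lia.
Qed.

(** Iterating [wave_gramSS] lowers both times together until the smaller one is 0 and the sum is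
    empty. *)
Lemma wave_gramE a b s d :
  wave_gram a b s s (d + s) = a 0 * \sum_(k < s) wave a b (d + 2 * k).+1 1.
Proof.
elim: s => [|s IH]; first by rewrite /wave_gram !big_ord0 mulr0.
rewrite addnS wave_gramSS IH big_ord_recr mulrDr; congr (_ + _ * wave _ _ _ _).
by move=> /=; lia.
Qed.

(* Column i is the state at time m - i: C^m lists the times backwards. *)
Definition wave_mx a b m : 'M[K]_m := \matrix_(n < m, i < m) wave a b (m - i) n.+1.

Lemma connecting_mxE a b T (r : (2 * T - 1).-tuple K) m :
    (forall k, (k <= 2 * m - 2)%N -> r`_k = wave a b k.+1 1) ->
  connecting_mx r m = (wave_mx a b m)^T *m wave_mx a b m.
Proof.
(* [wave_gramE] wants the smaller time first, which is [m - j] when [i <= j]; symmetry gives the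
   other case. *)
move=> ur; have key (i j : 'I_m) : (i <= j)%N ->
    wave_gram a b m (m - j) (m - i) =
    r`_0 * \sum_(0 <= k < (m - maxn i.+1 j.+1).+1) r`_(`|i - j| + 2 * k).
  move=> ij; have im := ltn_ord i; have jm := ltn_ord j.
  rewrite wave_gram_widen; last by lia.
  have ->: (m - i = (j - i) + (m - j))%N by lia.
  rewrite wave_gramE ur // wave11; congr (_ * _).
  rewrite (_ : (m - maxn i.+1 j.+1).+1 = m - j)%N; last by lia.
  rewrite big_mkord; apply: eq_bigr => k _; have km := ltn_ord k.
  rewrite ur; last by lia.
  by congr (wave _ _ _ _); lia.
apply/matrixP => i j; rewrite !mxE.
under [RHS]eq_bigr do rewrite !mxE.
have [ij|/ltnW ji] := leqP i j; first by rewrite -key // wave_gramC.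
by rewrite maxnC (_ : `|i - j|%N = `|j - i|%N) -?key //; lia.
Qed.

(** Compare [wave_gramSS] at times [m], [m.+1] for both systems: by finite speed the sums differ
    only at site [m.+1], through [b m.+1]. *)
Lemma wave_eval_even a b a' b' m :
    (forall i, (i <= m)%N -> a' i = a i) ->
    (forall i, (i <= m)%N -> b' i = b i) ->
  a 0 * wave a' b' (2 * m + 2) 1 =
    a 0 * wave a b (2 * m + 2) 1
    + (b' m.+1 - b m.+1) * wave a b m.+1 m.+1 ^+ 2.
Proof.
move=> ha hb.
have loc t n : (t + n <= 2 * m + 2)%N -> wave a' b' t n = wave a b t n.
  by move=> tn; apply: wave_local => i ?; [apply: ha | apply: hb]; lia.
have:= wave_gramSS a' b' m m.+1; have:= wave_gramSS a b m m.+1.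
rewrite ha // (_ : (m + m.+1).+1 = 2 * m + 2)%N; last by lia.
have -> : wave_gram a' b' m m m.+1 = wave_gram a b m m m.+1.
  by apply: eq_bigr => n _; rewrite !loc //; have := ltn_ord n; lia.
move: (wave_gram a b m m m.+1) => C.
rewrite /wave_gram !big_ord_recr /= !waveSS.
rewrite !(@wave_eq0 _ _ m.+1 m.+2) // !(@wave_eq0 _ _ m m.+1) // (ha m) //.
rewrite (loc m.+1 m.+1) ?(loc m.+1 m); [|lia..].
under [X in _ -> X + _ = _ -> _]eq_bigr => n _.
  rewrite !loc; [over | have := ltn_ord n; lia..].
by move=> /= e e'; apply: (addrI C); rewrite addrA -e -e'; ring.
Qed.

(** Same comparison at times [m.+1], [m.+1]: the sums differ only in the square of the diagonal
    value at [m.+2], which is [a m.+1] times the previous one. *)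
Lemma wave_eval_odd a b a' b' m :
    (forall i, (i <= m)%N -> a' i = a i) ->
    (forall i, (i <= m.+1)%N -> b' i = b i) ->
  a 0 * wave a' b' (2 * m + 3) 1 =
    a 0 * wave a b (2 * m + 3) 1
    + (a' m.+1 ^+ 2 - a m.+1 ^+ 2) * wave a b m.+1 m.+1 ^+ 2.
Proof.
move=> ha hb.
have loc t n : (t + n <= 2 * m + 3)%N -> wave a' b' t n = wave a b t n.
  by move=> tn; apply: wave_local => i ?; [apply: ha | apply: hb]; lia.
have:= wave_gramSS a' b' m.+1 m.+1; have:= wave_gramSS a b m.+1 m.+1.
rewrite ha // (_ : (m.+1 + m.+1).+1 = 2 * m + 3)%N; last by lia.
have -> : wave_gram a' b' m.+1 m.+1 m.+1 = wave_gram a b m.+1 m.+1 m.+1.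
  by apply: eq_bigr => n _; rewrite !loc //; have := ltn_ord n; lia.
move: (wave_gram a b m.+1 m.+1 m.+1) => C.
rewrite /wave_gram [in X in X -> _]big_ord_recr [in X in _ -> X -> _]big_ord_recr /=.
rewrite !(wave_diagS _ _ (ltn0Sn m)) (loc m.+1 m.+1); last by lia.
under [X in _ -> X + _ = _ -> _]eq_bigr => n _.
  rewrite !loc; [over | have := ltn_ord n; lia..].
by move=> /= e e'; apply: (addrI C); rewrite addrA -e -e'; ring.
Qed.

End Wave.

(** * Invertibility of C^m and reconstruction of the coefficients *)

Lemma wave_mx_unit (F : fieldType) (a b : nat -> F) m :
  (wave_mx a b m \in unitmx) = [forall i : 'I_m, a i != 0].
Proof.
pose L : 'M_m := \matrix_(i, n) wave a b i.+1 n.+1.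
(* Listing the times forwards makes the matrix triangular, by finite speed. *)
have -> : wave_mx a b m = L^T *m perm_mx (perm (@rev_ord_inj m))^-1%g.
  by rewrite -col_permE; apply/matrixP => n i; rewrite !mxE permE /= subnSK.
rewrite unitmx_mul unitmx_perm andbT unitmx_tr unitmxE unitfE det_trig; last first.
  by apply/is_trig_mxP => i n lt_in; rewrite mxE wave_eq0.
under eq_bigr do rewrite mxE wave_diag.
apply/prodf_neq0/forallP => [ne0 i|ne0 i _]; last first.
  by apply/prodf_neq0 => j _; apply: (ne0 (widen_ord (ltn_ord i) j)).
by have /prodf_neq0/(_ ord_max isT) := ne0 i isT.
Qed.

Lemma connecting_mx_unit (F : fieldType) (a b : nat -> F) T
    (r : (2 * T - 1).-tuple F) m :
    (forall k, (k <= 2 * m - 2)%N -> r`_k = wave a b k.+1 1) ->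
  (connecting_mx r m \in unitmx) = [forall i : 'I_m, a i != 0].
Proof.
by move=> ur; rewrite (connecting_mxE ur) unitmx_mul unitmx_tr andbb wave_mx_unit.
Qed.

Lemma response_realizable (K : numClosedFieldType) T (r : (2 * T - 1).-tuple K) m :
    (forall k, (k <= m)%N -> connecting_mx r k.+1 \in unitmx) ->
  exists a b : nat -> K, (forall i, (i <= m)%N -> a i != 0) /\
    forall k, (k <= 2 * m)%N -> r`_k = wave a b k.+1 1.
Proof.
elim: m => [|m IH] C_unit.
  (* The response at time 1 forces a_0 = r_0; the other values are placeholders. *)
  have r0 k : (k <= 2 * 0)%N -> r`_k = wave (fun=> r`_0) (fun=> 0) k.+1 1.
    by rewrite leqn0 => /eqP->.
  exists (fun=> r`_0), (fun=> 0); split=> // _ _.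
  by have:= C_unit 0 isT; rewrite (connecting_mx_unit (m := 1) r0) => /forallP/(_ ord0).
have{IH} [k km|a [b [a_neq0 ur]]] := IH; first by apply: C_unit; lia.
have a0 := a_neq0 0 isT.
set w := wave a b m.+1 m.+1.
have w0 : w != 0.
  by rewrite /w wave_diag; apply/prodf_neq0 => i _; rewrite a_neq0 // -ltnS.
(* Solves [wave_eval_even] for the value of [b m.+1] that produces r_{2m+1}. *)
pose b' := [eta b with
  m.+1 |-> b m.+1 + a 0 * (r`_(2 * m + 1) - wave a b (2 * m + 2) 1) / w ^+ 2].
(* The square that [wave_eval_odd] requires of the new [a m.+1]; the last term corrects for the
   arbitrary old value. *)
pose c := a 0 * (r`_(2 * m + 2) - wave a b' (2 * m + 3) 1) / w ^+ 2 + a m.+1 ^+ 2.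
pose a' := [eta a with m.+1 |-> 2.-root c].
have a'E i : (i <= m)%N -> a' i = a i by move=> im; rewrite /a' /= ifN //; lia.
have b'E i : (i <= m)%N -> b' i = b i by move=> im; rewrite /b' /= ifN //; lia.
have ur' k : (k <= 2 * m.+1)%N -> r`_k = wave a' b' k.+1 1.
  move=> km.
  have [km'|[->|->]] : (k <= 2 * m \/ k = 2 * m + 1 \/ k = 2 * m + 2)%N by lia.
  - by rewrite ur //; apply: wave_local => i ?; [rewrite a'E | rewrite b'E] => //; lia.
  - apply: (mulfI a0).
    rewrite (_ : (2 * m + 1).+1 = 2 * m + 2)%N; last by lia.
    rewrite (wave_eval_even a'E b'E) /b' /= eqxx -/w.
    by field.
  - apply: (mulfI a0).
    have b'E' : forall i, (i <= m.+1)%N -> b' i = b' i by [].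
    rewrite (_ : (2 * m + 2).+1 = 2 * m + 3)%N; last by lia.
    rewrite (wave_eval_odd a'E b'E').
    have -> : wave a b' m.+1 m.+1 = w.
      by apply: wave_local => // i ?; rewrite b'E //; lia.
    by rewrite {1}/a' /= eqxx rootCK // /c; field.
exists a', b'; split=> // i im.
(* The response now matches up to r_{2m+2}, so invertibility of C^{m+2} rules out a vanishing
   root. *)
have := C_unit m.+1 (leqnn _).
rewrite (connecting_mx_unit (a := a') (b := b')); last first.
  by move=> k ?; apply: ur'; lia.
by move=> /forallP/(_ (Ordinal (n := m.+2) (m := i) im)).
Qed.

Lemma bijective_mulmx (F : fieldType) m (A : 'M[F]_m) :
  bijective (fun x : 'cV_m => A *m x) <-> A \in unitmx.
Proof.
split=> [[g _ gK]|A_unit]; last first.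
  by exists (mulmx (invmx A)); [exact: mulKmx | exact: mulKVmx].
(* The values of [g] at the basis vectors are the columns of a right inverse. *)
suff /mulmx1_unit[] : A *m (\matrix_(i, j) g (col j 1%:M) i 0) = 1%:M by [].
apply/matrixP => i j; have /colP/(_ i) := gK (col j 1%:M).
by rewrite !mxE => <-; apply: eq_bigr => k _; rewrite !mxE.
Qed.

Theorem theorem4 (R : realType) (T : nat) (hT : (1 <= T)%N)
    (r : (2 * T - 1).-tuple (complex R)) :
  (exists a b : nat -> complex R,
     (forall n : nat, a n != 0) /\ is_response_vector a b r)
  <->
  (forall k : nat, (k <= T - 1)%N ->
     bijective (fun x : 'cV[complex R]_(T - k) =>
                  connecting_mx r (T - k) *m x)).
Proof.
split=> [[a [b [a_neq0 /is_response_vectorP ur]]] k kT|C_bij].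
  apply/bijective_mulmx; rewrite (connecting_mx_unit (a := a) (b := b)).
    exact/forallP.
  by move=> i ?; apply: ur; lia.
have [k kT|a [b [a_neq0 ur]]] := @response_realizable _ _ r (T - 1).
  have -> : k.+1 = (T - (T - k.+1))%N by lia.
  by apply/bijective_mulmx/C_bij; lia.
(* The reconstruction controls [a] only below [T]. By finite speed, resetting the tail to 1 leaves
   the response up to time 2T-1 unchanged. *)
pose a' n := if (n < T)%N then a n else 1.
exists a', b; split=> [n|].
  by rewrite /a'; case: ltnP => [nT|_]; [apply: a_neq0; lia | apply: oner_neq0].
apply/is_response_vectorP => k kT; rewrite ur; last by lia.
by apply: wave_local => // i iT; rewrite /a' ifT //; lia.
Qed.
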